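(* Let $\boldsymbol{K}\in\mathbb{R}^{n\times n}$ be any marginal kernel, i.e. a symmetric matrix with $\boldsymbol{0}\preceq\boldsymbol{K}\preceq\boldsymbol{I}$, and let $\mathcal{X}$ be its associated DPP. Denote by $\boldsymbol{V}\in\mathbb{R}^{n\times p}$ the matrix concatenating the $p\ge 0$ orthonormal eigenvectors of $\boldsymbol{K}$ associated with the eigenvalue $1$ (an orthonormal basis of that eigenspace), and let $\boldsymbol{L}=\boldsymbol{K}(\boldsymbol{I}-\boldsymbol{K})^{\dagger}$, where $\dagger$ denotes the Moore-Penrose pseudo-inverse. Then $\mathcal{X}$ is an extended L-ensemble based on the nonnegative pair $(\boldsymbol{L};\boldsymbol{V})$.
   Context: The ground set $\Omega$ has $n$ elements and is identified with $\{1,\dots,n\}$. For a matrix $\boldsymbol{M}$ and $X\subseteq\Omega$, $\boldsymbol{M}_X$ is the submatrix with rows and columns in $X$ and $\boldsymbol{M}_{X,:}$ the submatrix of rows in $X$. DPP: a random subset $\mathcal{X}\subseteq\Omega$ is the DPP with marginal kernel $\boldsymbol{K}$ if $\mathbf{P}(A\subseteq\mathcal{X})=\det\boldsymbol{K}_A$ for all $A\subseteq\Omega$, with $\det\boldsymbol{K}_\varnothing=1$. Nonnegative pair (NNP): a pair $(\boldsymbol{L};\boldsymbol{V})$ with $\boldsymbol{L}\in\mathbb{R}^{n\times n}$ symmetric, $\boldsymbol{V}\in\mathbb{R}^{n\times p}$ of full column rank, $0\le p\le n$ ($p=0$, with empty $\boldsymbol{V}$, is allowed), such that $\boldsymbol{x}^\top\boldsymbol{L}\boldsymbol{x}\ge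 0$ for every $\boldsymbol{x}\in\mathbb{R}^n$ with $\boldsymbol{V}^\top\boldsymbol{x}=0$. Extended L-ensemble based on the NNP $(\boldsymbol{L};\boldsymbol{V})$: a random subset $\mathcal{X}\subseteq\Omega$ with $$\forall X\subseteq\Omega,\quad \mathbf{P}(\mathcal{X}=X)\propto(-1)^p\det\begin{pmatrix}\boldsymbol{L}_X&\boldsymbol{V}_{X,:}\\(\boldsymbol{V}_{X,:})^\top&\boldsymbol{0}\end{pmatrix}$$ (the determinant of the empty matrix is $1$). *)

(* Defs.v *)
From HB Require Import structures.
From mathcomp Require Import all_boot all_order all_algebra.
From mathcomp Require Import all_classical all_reals all_analysis.

Set Implicit Arguments.
Unset Strict Implicit.
Unset Printing Implicit Defensive.

Import Order.TTheory GRing.Theory Num.Theory.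

Local Open Scope classical_set_scope.
Local Open Scope ring_scope.

(* 'I_n = {0, ..., n-1} plays the role of the ground set {1, ..., n}, and
   vectors of R^n are columns. *)

Section Matrices.
Variable R : realType.

Definition principal_submx n (M : 'M[R]_n) (X : {set 'I_n}) : 'M[R]_#|X| :=
  mxsub (fun i : 'I_#|X| => enum_val i) (fun i : 'I_#|X| => enum_val i) M.

Definition rows_submx n p (M : 'M[R]_(n, p)) (X : {set 'I_n}) :
    'M[R]_(#|X|, p) :=
  rowsub (fun i : 'I_#|X| => enum_val i) M.

Definition qform n (M : 'M[R]_n) (x : 'cV[R]_n) : R :=
  (x^T *m M *m x) ord0 ord0.

Definition loewner_le n (A B : 'M[R]_n) : Prop :=
  forall x : 'cV[R]_n, 0 <= qform (B - A) x.

Definition marginal_kernel n (K : 'M[R]_n) : Prop :=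
  [/\ K \is symmetricmx, loewner_le 0 K & loewner_le K 1%:M].

Definition penrose m n (A : 'M[R]_(m, n)) (B : 'M[R]_(n, m)) : Prop :=
  [/\ A *m B *m A = A, B *m A *m B = B,
      (A *m B)^T = A *m B & (B *m A)^T = B *m A].

(* The default value 0 of xget is never used: see [moore_penroseP]. *)
Definition moore_penrose m n (A : 'M[R]_(m, n)) : 'M[R]_(n, m) :=
  xget 0 [set B | penrose A B].

(* V^T has as rows the columns of V; eigenspace K 1 is the space of row vectors
   u with u *m K = u, which for symmetric K are the transposes of the columns x
   with K *m x = x. *)
Definition orthonormal_eigenbasis1 n p (K : 'M[R]_n) (V : 'M[R]_(n, p)) :
    Prop :=
  V^T *m V = 1%:M /\ (V^T == eigenspace K 1)%MS.

Definition nonnegative_pair n p (L : 'M[R]_n) (V : 'M[R]_(n, p)) : Prop :=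
  [/\ L \is symmetricmx, (p <= n)%N, \rank V = p &
      forall x : 'cV[R]_n, V^T *m x = 0 -> 0 <= qform L x].

Definition extended_weight n p (L : 'M[R]_n) (V : 'M[R]_(n, p))
    (X : {set 'I_n}) : R :=
  (-1) ^+ p * \det (block_mx (principal_submx L X) (rows_submx V X)
                             (rows_submx V X)^T    0).

Lemma gram_unit r n (F : 'M[R]_(r, n)) : row_free F -> F *m F^T \in unitmx.
Proof.
move=> freeF; rewrite -row_free_unit; apply/row_freeP.
have: kermx (F *m F^T) == 0.
  apply/eqP/row_matrixP => i; rewrite row0.
  set u := row i _.
  have uFF : u *m (F *m F^T) = 0 by rewrite /u -row_mul mulmx_ker row0.
  have uF : u *m F = 0.
    have : \sum_j (u *m F) ord0 j ^+ 2 = 0.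
      have /matrixP/(_ ord0 ord0) : (u *m F) *m (u *m F)^T = 0.
        by rewrite trmx_mul mulmxA -(mulmxA u) uFF mul0mx.
      rewrite mxE [RHS]mxE => E0; rewrite -[RHS]E0; apply: eq_bigr => j _.
      by rewrite [X in _ * X]mxE expr2.
    move=> /psumr_eq0P H; apply/rowP => j; rewrite [RHS]mxE.
    by apply/eqP; rewrite -sqrf_eq0; apply/eqP/H => // k _; exact: sqr_ge0.
  by apply: (row_free_inj freeF); rewrite uF mul0mx.
by rewrite kermx_eq0 => /row_freeP.
Qed.

Lemma penrose_full_rank_factor m r n (C : 'M[R]_(m, r)) (F : 'M[R]_(r, n)) :
  row_free C^T -> row_free F ->
  penrose (C *m F)
    (F^T *m invmx (F *m F^T) *m (invmx (C^T *m C) *m C^T)).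
Proof.
move=> /gram_unit; rewrite trmxK => uC /gram_unit uF.
set iF := invmx (F *m F^T); set iC := invmx (C^T *m C).
have iFT : iF^T = iF by rewrite /iF trmx_inv trmx_mul trmxK.
have iCT : iC^T = iC by rewrite /iC trmx_inv trmx_mul trmxK.
set B := (X in penrose _ X).
have AB : C *m F *m B = C *m (iC *m C^T).
  by rewrite /B -mulmxA !(mulmxA F) mulmxV // mul1mx.
have BA : B *m (C *m F) = F^T *m iF *m F.
  by rewrite /B -!mulmxA (mulmxA C^T) (mulmxA iC) mulVmx // mul1mx.
split.
- by rewrite AB -!mulmxA (mulmxA C^T) (mulmxA iC) mulVmx // mul1mx.
- by rewrite BA /B !mulmxA -(mulmxA _ F F^T) mulmxKV.
- by rewrite AB !trmx_mul trmxK iCT !mulmxA.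
- by rewrite BA !trmx_mul trmxK iFT !mulmxA.
Qed.

Lemma penrose_exists m n (A : 'M[R]_(m, n)) : exists B, penrose A B.
Proof.
have fC : row_free (col_base A)^T.
  by rewrite /row_free mxrank_tr; apply: col_base_full.
have := penrose_full_rank_factor fC (row_base_free A).
by rewrite mulmx_base => AB; exact: ex_intro AB.
Qed.

Lemma moore_penroseP m n (A : 'M[R]_(m, n)) : penrose A (moore_penrose A).
Proof. exact: (xgetPex 0 (penrose_exists A)). Qed.

Lemma penrose_unique m n (A : 'M[R]_(m, n)) (B C : 'M[R]_(n, m)) :
  penrose A B -> penrose A C -> B = C.
Proof.
move=> [b1 b2 b3 b4] [c1 c2 c3 c4].
have eAB : A *m B = A *m C.
  by rewrite -b3 -{1}c1 -mulmxA trmx_mul b3 c3 mulmxA b1.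
have eBA : B *m A = C *m A.
  by rewrite -b4 -{1}c1 -mulmxA mulmxA trmx_mul c4 b4 -mulmxA (mulmxA A) b1.
by rewrite -b2 eBA -mulmxA eAB mulmxA c2.
Qed.

End Matrices.

Section RandomSubsets.
Variables (R : realType) (d : measure_display) (T : measurableType d).
Variables (P : probability T R) (n : nat).

Definition random_subset (X : T -> {set 'I_n}) : Prop :=
  forall S : {set 'I_n}, measurable [set w | X w = S].

Definition is_DPP (K : 'M[R]_n) (X : T -> {set 'I_n}) : Prop :=
  random_subset X /\
  forall A : {set 'I_n},
    P [set w | A \subset X w] = (\det (principal_submx K A))%:E.

Definition extended_L_ensemble p (L : 'M[R]_n) (V : 'M[R]_(n, p))
    (X : T -> {set 'I_n}) : Prop :=
  [/\ nonnegative_pair L V, random_subset X &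
      exists2 c : R, 0 < c &
        forall S : {set 'I_n},
          P [set w | X w = S] = (c * extended_weight L V S)%:E].

End RandomSubsets.

(* Main.v *)
Require Import Defs.
From mathcomp Require Import all_boot all_order all_algebra.
From mathcomp Require Import all_classical all_reals all_analysis.
From mathcomp Require Import lra.

(** Write M = I - K, B for the pseudo-inverse of M, and Q = V V^T, the
orthogonal projection onto the eigenspace of K for 1, which is the kernel of M.

Law of the DPP. Let D be the diagonal 0/1 matrix of the coordinates in S.
Expanding a determinant along a sum in each row gives
<<det K_A = \sum_(S | A \subset S) det (D K + (I - D) (I - K))>>
([sum_elementary_weights]). The inclusion probabilities are the same sums over
supersets of the numbers P(X = S), and such sums determine their terms
([superset_sum_inj]), so P(X = S) = det (D K + (I - D) M) ([DPP_atom]).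

Extended weights. Since D is E^T E for a matrix E with orthonormal rows,
Sylvester's identity [det_1DmulC] rewrites the bordered determinant of L_S and
V_S as a determinant of fixed size n + p ([extended_weight_bordered]). From
M B = B M = I - Q one gets L M = K - Q and L V = 0, hence, in block form,
<<[I + D (L - I), D V; V^T, 0] [M, V; V^T, 0]
  = [D K + (I - D) M, (I - D) V; 0, I]>>.
The second factor on the left has determinant (-1)^p det (M + Q)
([det_bordered]). Taking determinants, P(X = S) is det (M + Q) times the
extended weight of S ([extended_weight_det]).

It remains to see that det (M + Q) is positive and (L; V) is a nonnegative pair.
The matrix M + Q is positive semidefinite and invertible, with inverse B + Q,
and the segment joining it to I meets no singular matrix ([psd_unit_det_gt0]). As
L = K B = B (K M) B and K M = K M K + M K M, the matrix L is positive
semidefinite on the whole space ([extended_kernel_psd]). *)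

Import Order.TTheory GRing.Theory Num.Theory.
Local Open Scope ring_scope.

Set Implicit Arguments.
Unset Strict Implicit.
Unset Printing Implicit Defensive.

(** * Determinant identities *)

(** Sylvester's identity: both sides are the determinant of one block matrix,
cleared by the same elementary block from the left and from the right. *)
Lemma det_1DmulC (R : comPzRingType) m n (A : 'M[R]_(m, n)) (B : 'M[R]_(n, m)) :
  \det (1%:M + A *m B) = \det (1%:M + B *m A).
Proof.
pose C := block_mx 1%:M (- B) A 1%:M; pose T := block_mx 1%:M 0 (- A) 1%:M.
have detT : \det T = 1 by rewrite det_lblock !det1 mulr1.
have TC : T *m C = block_mx 1%:M (- B) 0 (1%:M + A *m B).
  rewrite mulmx_block !mul1mx !mul0mx !mulmx1 !addr0.
  by rewrite mulNmx mulmxN opprK addNr addrC.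
have CT : C *m T = block_mx (1%:M + B *m A) (- B) 0 1%:M.
  rewrite mulmx_block !mul1mx !mulmx1 !mulmx0 !add0r.
  by rewrite mulNmx mulmxN opprK subrr.
transitivity (\det (T *m C)); first by rewrite TC det_ublock det1 mul1r.
transitivity (\det (C *m T)); last by rewrite CT det_ublock det1 mulr1.
by rewrite !det_mulmx mulrC.
Qed.

(** When the rows of E are orthonormal, E^T E is the projection onto their
span: a determinant compressed to that span becomes one of full size. *)
Lemma det_compression (R : comPzRingType) m n (E : 'M[R]_(m, n)) (A : 'M[R]_n) :
  E *m E^T = 1%:M ->
  \det (1%:M + E^T *m E *m (A - 1%:M)) = \det (E *m A *m E^T).
Proof.
move=> E1; rewrite -mulmxA det_1DmulC -mulmxA mulmxBl mul1mx mulmxBr E1.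
by rewrite addrC subrK mulmxA.
Qed.

(** Multilinearity in the rows, obtained by distributing each product of the
Leibniz formula over the set of rows where the F summand is chosen. *)
Lemma det_row_sum (R : comPzRingType) n (F G : 'M[R]_n) :
  \det (F + G) = \sum_(S : {set 'I_n})
    \det (\matrix_(i, j) (if i \in S then F i j else G i j)).
Proof.
rewrite exchange_big /=; apply: eq_bigr => s _.
rewrite -big_distrr /=; congr (_ * _).
under eq_bigr do rewrite mxE.
rewrite bigA_distr; apply: eq_bigr => S _.
by apply: eq_bigr => i _; rewrite mxE.
Qed.

(** Uniqueness in Moebius inversion on the lattice of subsets, by induction on
the size of the complement. *)
Lemma superset_sum_inj (R : zmodType) (I : finType) (f g : {set I} -> R) :
  (forall A : {set I}, \sum_(S : {set I} | A \subset S) f S =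
                       \sum_(S : {set I} | A \subset S) g S) ->
  f =1 g.
Proof.
move=> fg A; have [k] := ubnP #|~: A|; elim: k A => // k IH A ltAk.
have := fg A; rewrite (bigD1 A) //= [RHS](bigD1 A) //=.
suff -> : \sum_(S : {set I} | (A \subset S) && (S != A)) f S =
          \sum_(S : {set I} | (A \subset S) && (S != A)) g S by move/addIr.
apply: eq_bigr => S /andP[AS neSA]; apply: IH.
rewrite -ltnS; apply: leq_trans ltAk; rewrite ltnS; apply: proper_card.
by rewrite finset.properC finset.properEneq eq_sym neSA.
Qed.

(** * Positive semidefinite matrices *)

Lemma qformD (R : realType) n (A B : 'M[R]_n) x :
  qform (A + B) x = qform A x + qform B x.
Proof. by rewrite /qform mulmxDr mulmxDl mxE. Qed.

Lemma qform_congr (R : realType) m n (A : 'M[R]_m) (C : 'M[R]_(m, n)) x :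
  qform (C^T *m A *m C) x = qform A (C *m x).
Proof. by rewrite /qform trmx_mul !mulmxA. Qed.

Lemma qform1_gt0 (R : realType) n (x : 'cV[R]_n) : x != 0 -> 0 < qform 1%:M x.
Proof.
move=> x0; have E : qform 1%:M x = \sum_i x i ord0 ^+ 2.
  rewrite /qform mulmx1 mxE; apply: eq_bigr => i _.
  by rewrite mxE expr2.
rewrite lt_def E sumr_ge0 ?andbT; last by move=> i _; exact: sqr_ge0.
apply: contra x0 => /eqP/psumr_eq0P H; apply/eqP/colP => i; rewrite [RHS]mxE.
by apply/eqP; rewrite -sqrf_eq0; apply/eqP/H => // j _; exact: sqr_ge0.
Qed.

(** The determinant of (1 - t) N + t I is a polynomial in t equal to 1 at t = 1.
If it were nonpositive at t = 0, it would vanish somewhere on the segment; but a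
null vector of (1 - t) N + t I is zero, by invertibility of N if t = 0 and
because the quadratic form is at least t times the squared norm otherwise. *)
Lemma psd_unit_det_gt0 (R : realType) n (N : 'M[R]_n) :
  loewner_le 0 N -> N \in unitmx -> 0 < \det N.
Proof.
move=> N0 uN; rewrite ltNge; apply/negP => dN.
pose p : {poly R} :=
  \det (map_mx polyC N + 'X *: map_mx polyC (1%:M - N)).
have pE t : p.[t] = \det (N + t *: (1%:M - N)).
  rewrite /p -horner_evalE -det_map_mx; congr (\det _); apply/matrixP => i j.
  by rewrite !mxE /= /horner_eval !hornerE.
have p0 : p.[0] <= 0 by rewrite pE scale0r addr0.
have p1 : 0 <= p.[1] by rewrite pE scale1r addrC subrK det1.
have [t /andP[t0 t1] /rootP] :=
  poly_ivt ler01 (introT andP (conj p0 p1)).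
rewrite pE => /eqP/det0P[v v0 vA].
have [t0'|tn0] := eqVneq t 0.
  move: vA; rewrite t0' scale0r addr0 => vN; case/eqP: v0.
  by rewrite -[v](mulmxK uN) vN mul0mx.
have tp : 0 < t by rewrite lt_def tn0.
have := N0 v^T; rewrite subr0 => Nv.
have Iv : 0 < qform 1%:M v^T.
  by apply: qform1_gt0; apply: contra v0 => /eqP E; rewrite -[v]trmxK E trmx0.
have : (v *m (N + t *: (1%:M - N)) *m v^T) ord0 ord0 = 0.
  by rewrite vA mul0mx mxE.
have -> : v *m (N + t *: (1%:M - N)) *m v^T =
   (1 - t) *: (v *m N *m v^T) + t *: (v *m 1%:M *m v^T).
  rewrite mulmxDr mulmxDl -scalemxAr -scalemxAl mulmxBr mulmxBl.
  by rewrite scalerBr scalerBl scale1r addrA addrAC.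
rewrite mxE [X in X + _]mxE [X in _ + X]mxE.
move: Nv Iv; rewrite /qform trmxK => Nv Iv E.
have := mulr_gt0 tp Iv; have := mulr_ge0 (_ : 0 <= 1 - t) Nv.
rewrite subr_ge0 => /(_ t1); lra.
Qed.

(** * Selecting coordinates *)

Section Selection.
Variables (R : realType) (n : nat).
Implicit Types (S A : {set 'I_n}).

(** The diagonal 0/1 matrix of S, factored through the matrix that selects the
coordinates in S so that [det_compression] applies to it. *)
Definition coord_proj S : 'M[R]_n :=
  (rows_submx 1%:M S)^T *m rows_submx 1%:M S.

Lemma rows_submxE p (M : 'M[R]_(n, p)) S :
  rows_submx M S = rows_submx 1%:M S *m M.
Proof. exact: rowsubE. Qed.

Lemma principal_submxE (M : 'M[R]_n) S :
  principal_submx M S = rows_submx 1%:M S *m M *m (rows_submx 1%:M S)^T.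
Proof.
rewrite -rows_submxE; apply/matrixP => i j; rewrite !mxE.
rewrite (bigD1 (enum_val j)) //= !mxE eqxx mulr1 big1 ?addr0 // => k kj.
by rewrite !mxE [_ == k]eq_sym (negPf kj) mulr0.
Qed.

Lemma rows_submx1_mul_tr S :
  rows_submx 1%:M S *m (rows_submx 1%:M S)^T = 1%:M :> 'M[R]_#|S|.
Proof.
rewrite -[X in X *m _]mulmx1 -principal_submxE.
by apply/matrixP => i j; rewrite !mxE (inj_eq enum_val_inj).
Qed.

Lemma coord_proj_mulE p (F : 'M[R]_(n, p)) S i j :
  (coord_proj S *m F) i j = if i \in S then F i j else 0.
Proof.
rewrite -mulmxA -rows_submxE mxE.
under eq_bigr do rewrite !mxE.
rewrite -(big_enum_val (fun k => (k == i)%:R * F k j)) /=.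
case: ifP => iS.
  rewrite (bigD1 i) //= eqxx mul1r big1 ?addr0 // => k /andP[_ /negPf->].
  by rewrite mul0r.
rewrite big1 // => k kS; have [ki|] := eqVneq k i; last by rewrite mul0r.
by rewrite ki iS in kS.
Qed.

Lemma det_principal_submx (M : 'M[R]_n) S :
  \det (principal_submx M S) = \det (1%:M + coord_proj S *m (M - 1%:M)).
Proof.
by rewrite principal_submxE -(det_compression _ (rows_submx1_mul_tr S)).
Qed.

(** The bordered matrix is compressed by the selection of S on the first n
coordinates and by the identity on the p bordering ones. *)
Lemma extended_weight_bordered p (L : 'M[R]_n) (V : 'M[R]_(n, p)) S :
  extended_weight L V S = (-1) ^+ p *
    \det (block_mx (1%:M + coord_proj S *m (L - 1%:M)) (coord_proj S *m V)
                   V^T 0).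
Proof.
congr (_ * _); rewrite principal_submxE (rows_submxE V).
set E := rows_submx 1%:M S.
pose E' : 'M[R]_(#|S| + p, n + p) := block_mx E 0 0 1%:M.
have E'1 : E' *m E'^T = 1%:M.
  rewrite tr_block_mx !trmx0 trmx1 mulmx_block.
  rewrite !mul0mx !mulmx0 !addr0 mulmx1 add0r rows_submx1_mul_tr.
  by rewrite -scalar_mx_block.
transitivity (\det (E' *m block_mx L V V^T 0 *m E'^T)).
  rewrite /E' tr_block_mx !trmx0 trmx1 !mulmx_block.
  rewrite !(mul0mx, mulmx0, mul1mx, mulmx1, addr0, add0r).
  by rewrite trmx_mul.
rewrite -(det_compression _ E'1) /E' tr_block_mx !trmx0 trmx1 mulmx_block.
rewrite !mul0mx !mulmx0 !addr0 mulmx1 add0r (scalar_mx_block n p 1).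
rewrite opp_block_mx add_block_mx mulmx_block add_block_mx.
by rewrite !(mul0mx, oppr0, addr0, add0r, mul1mx) subrr.
Qed.

(** If D is the projection on A, the right-hand side is
det (K + (I - D) (I - K)). In its expansion by [det_row_sum] the terms where S
misses some i in A have a zero row i. *)
Lemma sum_elementary_weights (K : 'M[R]_n) A :
  \sum_(S : {set 'I_n} | A \subset S)
    \det (coord_proj S *m K + (1%:M - coord_proj S) *m (1%:M - K)) =
  \det (principal_submx K A).
Proof.
rewrite det_principal_submx.
have -> : 1%:M + coord_proj A *m (K - 1%:M) =
    K + (1%:M - coord_proj A) *m (1%:M - K).
  rewrite mulmxBl mul1mx -[K - _]opprB mulmxN addrA; congr (_ - _).
  by rewrite addrC subrK.
rewrite det_row_sum [RHS](bigID (fun S : {set 'I_n} => A \subset S)) /=.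
rewrite [X in _ = _ + X]big1 ?addr0 => [|S /subsetPn[i iA iS]].
  apply: eq_bigr => S /fintype.subsetP AS; congr (\det _); apply/matrixP => i j.
  rewrite [LHS]mxE coord_proj_mulE [RHS]mxE.
  have -> : ((1%:M - coord_proj S) *m (1%:M - K)) i j =
            if i \in S then 0 else (1%:M - K) i j.
    rewrite mulmxBl mul1mx mxE [X in _ + X]mxE coord_proj_mulE.
    by case: ifP => _; rewrite ?subrr ?subr0.
  case: ifP => iS; first by rewrite addr0.
  rewrite add0r mulmxBl mul1mx [RHS]mxE [X in _ = _ + X]mxE coord_proj_mulE.
  by case: ifP => [/AS|_]; rewrite ?iS ?subr0.
rewrite (expand_det_row _ i) big1 // => j _.
rewrite mxE (negPf iS) mulmxBl mul1mx [X in X * _]mxE [X in _ + X]mxE.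
by rewrite coord_proj_mulE iA subrr mul0r.
Qed.

End Selection.

(** * The pair built from a marginal kernel *)

Lemma moore_penrose_sym (R : realType) n (A : 'M[R]_n) :
  A^T = A -> (moore_penrose A)^T = moore_penrose A.
Proof.
move=> AT; have pB := moore_penroseP A; have [b1 b2 b3 b4] := pB.
set B := moore_penrose A in pB b1 b2 b3 b4 *.
apply: penrose_unique pB; split.
- by rewrite -[X in X *m _ *m X]AT -!trmx_mul mulmxA b1.
- by rewrite -[X in _ *m X *m _]AT -!trmx_mul mulmxA b2.
- by rewrite -[X in X *m _]AT -trmx_mul b4.
- by rewrite -[X in _ *m X]AT -trmx_mul b3.
Qed.

Lemma moore_penrose_comm (R : realType) n (A : 'M[R]_n) :
  A^T = A -> A *m moore_penrose A = moore_penrose A *m A.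
Proof.
move=> AT; have [_ _ <- _] := moore_penroseP A.
by rewrite trmx_mul AT moore_penrose_sym.
Qed.

Lemma marginal_kernelP (R : realType) n (K : 'M[R]_n) :
  marginal_kernel K ->
  [/\ K^T = K, forall x, 0 <= qform K x & forall x, 0 <= qform (1%:M - K) x].
Proof.
move=> [/is_hermitianmxP]; rewrite expr0 scale1r => KT K0 K1; split => //.
  by rewrite [RHS]KT; apply/matrixP => i j; rewrite !mxE.
by move=> x; have := K0 x; rewrite subr0.
Qed.

Section Eigenbasis.
Variables (R : realType) (n p : nat) (K : 'M[R]_n) (V : 'M[R]_(n, p)).
Hypotheses (HK : marginal_kernel K) (HV : orthonormal_eigenbasis1 K V).
Let M := 1%:M - K.
Let B := moore_penrose M.
Let Q := V *m V^T.
Let L := K *m B.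

Let KT : K^T = K. Proof. by have [] := marginal_kernelP HK. Qed.
Let MT : M^T = M. Proof. by rewrite linearB /= trmx1 KT. Qed.
Let BT : B^T = B. Proof. exact: moore_penrose_sym. Qed.
Let VTV : V^T *m V = 1%:M. Proof. by have [] := HV. Qed.

Let VTM : V^T *m M = 0.
Proof.
have [_ /andP[/eigenspaceP VK _]] := HV.
by rewrite mulmxBr mulmx1 VK scale1r subrr.
Qed.

Let MV : M *m V = 0.
Proof. by rewrite -[LHS]trmxK trmx_mul MT VTM trmx0. Qed.

Let MBC : M *m B = B *m M. Proof. exact: moore_penrose_comm. Qed.

(** The rows of I - M B are killed by M, hence are combinations of the rows of
V^T, on which Q acts as the identity; while M B Q = B M Q = 0. *)
Lemma eigenbasis1_complement : M *m B = 1%:M - Q.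
Proof.
have [MBM _ _ _] := moore_penroseP M; rewrite -/B in MBM.
have [C PC] : exists C, 1%:M - M *m B = C *m V^T.
  apply/submxP; have [_ /andP[_ sV]] := HV; apply: submx_trans sV.
  apply/eigenspaceP; rewrite scale1r -[X in _ *m X](subKr 1%:M) -/M.
  by rewrite mulmxBr mulmx1 [_ *m M]mulmxBl mul1mx MBM subrr subr0.
have : (1%:M - M *m B) *m Q = 1%:M - M *m B.
  by rewrite PC /Q mulmxA -(mulmxA C) VTV mulmx1.
rewrite mulmxBl mul1mx MBC -(mulmxA B) /Q (mulmxA M) MV mul0mx mulmx0 subr0.
by move=> ->; rewrite subKr.
Qed.

Let BV : B *m V = 0.
Proof.
have [_ BMB _ _] := moore_penroseP M; rewrite -/B in BMB.
by rewrite -BMB -mulmxA -mulmxA (mulmxA M) MBC -(mulmxA B) MV !mulmx0.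
Qed.

Lemma extended_kernelE : L = B + Q - 1%:M.
Proof.
rewrite /L -[K](subKr 1%:M) -/M mulmxBl mul1mx eigenbasis1_complement.
by rewrite opprB addrA.
Qed.

Lemma extended_kernel_sym : L^T = L.
Proof.
by rewrite extended_kernelE linearB linearD /= trmx1 BT trmx_mul trmxK.
Qed.

(** K and M commute and K + M = I, so K M = K M K + M K M, a sum of two
congruences of positive semidefinite matrices; and L is B (K M) B. *)
Lemma extended_kernel_psd x : 0 <= qform L x.
Proof.
have [_ K0 M0] := marginal_kernelP HK.
have [_ BMB _ _] := moore_penroseP M; rewrite -/B in BMB.
have KB : K *m B = B *m K.
  by rewrite -[K](subKr 1%:M) -/M mulmxBl mulmxBr mul1mx mulmx1 MBC.
have KM : K *m M = M *m K by rewrite /M mulmxBl mulmxBr mul1mx mulmx1.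
have KME : K *m M = K *m M *m K + M *m K *m M.
  rewrite -KM -mulmxDr (_ : K + M = 1%:M) ?mulmx1 //.
  by rewrite addrC subrK.
have -> : L = (K *m B)^T *m M *m (K *m B) + (M *m B)^T *m K *m (M *m B).
  rewrite !trmx_mul BT KT MT -!mulmxA -mulmxDr !mulmxA -!mulmxDl.
  by rewrite -KME -[in RHS]mulmxA /L -{1}BMB !mulmxA KB.
rewrite qformD !qform_congr.
by apply: addr_ge0; [exact: M0 | exact: K0].
Qed.

Lemma eigenbasis1_rank : \rank V = p.
Proof.
apply/eqP; rewrite eqn_leq rank_leq_col /=.
by rewrite -[X in (X <= _)%N](mxrank1 R) -VTV mxrankM_maxr.
Qed.

Lemma extended_kernel_NNP : nonnegative_pair L V.
Proof.
split.
- apply/is_hermitianmxP; rewrite expr0 scale1r -[LHS]extended_kernel_sym.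
  by apply/matrixP => i j; rewrite !mxE.
- by rewrite -eigenbasis1_rank rank_leq_row.
- exact: eigenbasis1_rank.
- by move=> x _; exact: extended_kernel_psd.
Qed.

Let N := M + Q.

Lemma extended_det_gt0 : 0 < \det N.
Proof.
have [_ _ M0] := marginal_kernelP HK.
apply: psd_unit_det_gt0.
  move=> x; rewrite subr0.
  have -> : qform N x = qform M x + qform 1%:M (V^T *m x).
    rewrite /N qformD /Q -[X in X *m _]trmxK -[X in X *m _]mulmx1.
    by rewrite qform_congr.
  apply: addr_ge0; first exact: M0.
  have [->|/qform1_gt0/ltW //] := eqVneq (V^T *m x) 0.
  by rewrite /qform mulmx0 mxE.
have NBQ : N *m (B + Q) = 1%:M.
  have VTB : V^T *m B = 0 by rewrite -[LHS]trmxK trmx_mul trmxK BT BV trmx0.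
  rewrite /N mulmxDl !mulmxDr eigenbasis1_complement /Q mulmxA MV mul0mx addr0.
  by rewrite -!mulmxA VTB (mulmxA V^T) VTV mulmx0 mul1mx add0r subrK.
by have [] := mulmx1_unit NBQ.
Qed.

(** Subtracting the first block column times V from the second turns the lower
right block into - I, against which V is eliminated from the first block row. *)
Lemma det_bordered : \det (block_mx M V V^T 0) = (-1) ^+ p * \det N.
Proof.
pose U := block_mx (1%:M : 'M[R]_n) (- V) 0 (1%:M : 'M[R]_p).
have E : block_mx (1%:M : 'M[R]_n) V 0 (1%:M : 'M[R]_p) *m
         (block_mx M V V^T 0 *m U) = block_mx N 0 V^T (- 1%:M).
  rewrite !mulmx_block !mulmx1 !mulmx0 !addr0 !mul1mx !mul0mx !add0r.
  by rewrite !mulmxN MV VTV oppr0 add0r mulmx1 subrr.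
have := congr1 (fun A => \det A) E.
rewrite !det_mulmx /U !det_ublock det_lblock !det1 !mul1r !mulr1 => ->.
by rewrite -scaleN1r detZ det1 mulr1 mulrC.
Qed.

(** The determinant of the block product displayed at the top. The power (-1)^p
in the weight is the one that [det_bordered] produces. *)
Lemma extended_weight_det S :
  \det (coord_proj R S *m K + (1%:M - coord_proj R S) *m M) =
  \det N * extended_weight L V S.
Proof.
set D := coord_proj R S; rewrite extended_weight_bordered -/D.
have LM : L *m M = K - Q.
  rewrite /L -mulmxA -MBC eigenbasis1_complement mulmxBr mulmx1.
  congr (_ - _); rewrite -[K](subKr 1%:M) -/M mulmxBl mul1mx.
  by rewrite [M *m _]mulmxA MV mul0mx subr0.
have LV : L *m V = 0 by rewrite /L -mulmxA BV mulmx0.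
have E : block_mx (1%:M + D *m (L - 1%:M)) (D *m V) V^T 0 *m
         block_mx M V V^T 0 =
         block_mx (D *m K + (1%:M - D) *m M) (V - D *m V) 0 1%:M.
  rewrite mulmx_block !mulmx0 !mul0mx !addr0 VTM VTV; congr block_mx.
    rewrite mulmxDl mul1mx -mulmxA mulmxBl mul1mx LM -mulmxA -/Q.
    (* M is generalised, lest distributivity expand it as I - K. *)
    move: (M) => M'; rewrite !mulmxBr mulmxBl mul1mx.
    rewrite [D *m K - _]addrC -!addrA [RHS]addrCA; congr (_ + _).
    by rewrite addrC !addrA addrK.
  by rewrite mulmxDl mul1mx -mulmxA mulmxBl mul1mx LV sub0r mulmxN.
have := congr1 (fun A => \det A) E.
rewrite det_mulmx det_ublock det1 mulr1 det_bordered => <-.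
by rewrite mulrCA mulrA mulrC mulrA.
Qed.

End Eigenbasis.

(** * The law of the DPP *)

Section DPP.
Variables (R : realType) (d : measure_display) (T : measurableType d).
Variables (P : probability T R) (n : nat).
Local Open Scope classical_set_scope.

(** Both families have the principal minors of K as their sums over supersets:
the probabilities by additivity, the determinants by
[sum_elementary_weights]. *)
Lemma DPP_atom (K : 'M[R]_n) (X : T -> {set 'I_n}) : is_DPP P K X ->
  forall S, P [set w | X w = S] =
    (\det (coord_proj R S *m K + (1%:M - coord_proj R S) *m (1%:M - K)))%:E.
Proof.
move=> [mX PX] S.
have fX A : P [set w | X w = A] \is a fin_num by apply: fin_num_measure.
rewrite -[LHS]fineK //; congr (_%:E).
move: S; apply: superset_sum_inj => A; rewrite sum_elementary_weights.
apply: EFin_inj; rewrite -PX -sumEFin.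
under eq_bigr do rewrite fineK //.
have -> : [set w | A \subset X w] =
    \bigcup_(S in [set S : {set 'I_n} | A \subset S]) [set w | X w = S].
  by apply/seteqP; split => w /= => [AX|[S /= AS ->//]]; exists (X w).
rewrite measure_fin_bigcup //; first last.
- by move=> S1 S2 _ _ [w [/= <- <-]].
- exact: finite_finset.
pose r := [seq S : {set 'I_n} <- enum {set 'I_n} | A \subset S].
rewrite (@fsbigE _ _ _ _ _ r) /r; first last.
- by move=> S /= AS; rewrite mem_filter AS mem_enum.
- by move=> S /=; rewrite mem_filter => /andP[].
- by rewrite filter_uniq // enum_uniq.
rewrite big_filter_cond big_enum_cond /=.
apply: eq_bigl => S; rewrite andbC; case: (boolP (A \subset S)) => AS //=.
  by rewrite mem_set.
by rewrite andbF.
Qed.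

End DPP.

Theorem theorem2p10 (R : realType) (d : measure_display)
    (T : measurableType d) (P : probability T R) (n p : nat)
    (K : 'M[R]_n) (X : T -> {set 'I_n}) (V : 'M[R]_(n, p))
    (HK : marginal_kernel K)
    (HX : is_DPP P K X)
    (HV : orthonormal_eigenbasis1 K V) :
  extended_L_ensemble P (K *m moore_penrose (1%:M - K)) V X.
Proof.
split; [exact: extended_kernel_NNP | by case: HX |].
exists (\det (1%:M - K + V *m V^T)); first exact: extended_det_gt0.
by move=> S; rewrite (DPP_atom HX) (extended_weight_det HK HV).
Qed.
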